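(* Let $k$ be a field, let $H\subsetneq\mathbb N$ be a numerical semigroup, and let $R=k[[H]]$. Set $\omega_R=\sum_{\gamma\in\mathrm{PF}(H)}Rt^{-\gamma}$, which is a canonical module of $R$. Then the following conditions are equivalent: (i) There exists an exact sequence of $R$-modules $0\to R\to\omega_R\to C\to 0$ with $C\neq0$ such that $C$ has $k$ as a direct summand. (ii) There exists $\delta\in\mathrm{PF}(H)$ such that $\omega_R/Rt^{-\delta}$ has $k$ as a direct summand. (iii) There exist $\alpha,\beta\in\mathrm{PF}(H)$ such that $\alpha+\beta\in\mathrm{PF}(H)$.
   Context: $\mathbb N=\{0,1,2,\ldots\}$. A numerical semigroup is a subset $H\subseteq\mathbb N$ containing $0$, closed under addition, with finite complement in $\mathbb N$. Its numerical semigroup ring is $k[[H]]=k[[t^h\mid h\in H]]\subseteq k[[t]]$, a one-dimensional Cohen--Macaulay complete local domain with residue field $k$. The set of pseudo-Frobenius numbers is $\mathrm{PF}(H)=\{a\in\mathbb N\setminus H\mid a+h\in H\text{ for all }h\in H\setminus\{0\}\}$. The $R$-submodule $\sum_{\gamma\in\mathrm{PF}(H)}Rt^{-\gamma}$ is taken inside the field of fractions $k((t))$. The module $k$ is the residue field of $R$. In dimension one, condition (i) is the paper's definition of ''$R$ satisfies condition $(\ast)$''. *)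

(* Defs.v *)
From HB Require Import structures.
From mathcomp Require Import all_boot all_order all_algebra.
From mathcomp Require Import generic_quotient ring_quotient fraction.
From mathcomp Require Import boolp classical_sets functions cardinality.

Set Implicit Arguments.
Unset Strict Implicit.
Unset Printing Implicit Defensive.

Import GRing.Theory.
Local Open Scope ring_scope.

Record numerical_semigroup := NumericalSemigroup {
  nsg_set :> set nat;
  nsg0 : nsg_set 0%N;
  nsgD : forall a b, nsg_set a -> nsg_set b -> nsg_set (a + b)%N;
  nsg_cofinite : finite_set (~` nsg_set)%classic
}.

Definition PF (H : set nat) : set nat :=
  [set a | ~ H a /\ forall h, H h -> h != 0%N -> H (a + h)%N]%classic.

Record fps (k : fieldType) := Fps { fcoef :> nat -> k }.

HB.instance Definition _ (k : fieldType) := [isNew for @fcoef k].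
HB.instance Definition _ (k : fieldType) := [Choice of fps k by <:].

Section FpsRing.
Variable k : fieldType.
Implicit Types (f g h : fps k) (n : nat).

Lemma fpsP f g : (forall n, f n = g n) <-> f = g.
Proof. by split=> [fg|->//]; apply/val_inj/funext => n; apply: fg. Qed.

Definition fps_zero : fps k := Fps (fun=> 0).
Definition fps_opp f : fps k := Fps (fun n => - f n).
Definition fps_add f g : fps k := Fps (fun n => f n + g n).
Definition fps_one : fps k := Fps (fun n => (n == 0%N)%:R).
Definition fps_mul f g : fps k :=
  Fps (fun n => \sum_(i < n.+1) f i * g (n - i)%N).

Fact fps_addA : associative fps_add.
Proof. by move=> f g h; apply/fpsP=> n /=; rewrite addrA. Qed.
Fact fps_addC : commutative fps_add.
Proof. by move=> f g; apply/fpsP=> n /=; rewrite addrC. Qed.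
Fact fps_add0 : left_id fps_zero fps_add.
Proof. by move=> f; apply/fpsP=> n /=; rewrite add0r. Qed.
Fact fps_addN : left_inverse fps_zero fps_opp fps_add.
Proof. by move=> f; apply/fpsP=> n /=; rewrite addNr. Qed.

HB.instance Definition _ :=
  GRing.isZmodule.Build (fps k) fps_addA fps_addC fps_add0 fps_addN.

Let tr N f : {poly k} := \poly_(i < N.+1) f i.

Let coef_tr N f n : (n <= N)%N -> (tr N f)`_n = f n.
Proof. by move=> nN; rewrite coef_poly ltnS nN. Qed.

Let coef_mul_eq (p p' q q' : {poly k}) N :
  (forall n, (n <= N)%N -> p`_n = p'`_n) ->
  (forall n, (n <= N)%N -> q`_n = q'`_n) ->
  forall n, (n <= N)%N -> (p * q)`_n = (p' * q')`_n.
Proof.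
move=> pE qE n nN; rewrite !coefM; apply: eq_bigr => i _.
by rewrite pE ?qE // (leq_trans _ nN) ?leq_subr // -ltnS.
Qed.

Let coef_trM N f g n : (n <= N)%N -> (tr N f * tr N g)`_n = fps_mul f g n.
Proof.
move=> nN; rewrite coefM /=; apply: eq_bigr => i _.
by rewrite !coef_tr // (leq_trans _ nN) ?leq_subr // -ltnS.
Qed.

Let trM N f g n : (n <= N)%N -> (tr N (fps_mul f g))`_n = (tr N f * tr N g)`_n.
Proof. by move=> nN; rewrite coef_tr // coef_trM. Qed.

Fact fps_mulA : associative fps_mul.
Proof.
move=> f g h; apply/fpsP=> n.
rewrite -!(@coef_trM n) // (@coef_mul_eq _ (tr n f) _ (tr n g * tr n h) n) //;
  last exact: trM.
rewrite mulrA; apply: (@coef_mul_eq _ _ _ _ n) => // m mn.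
by rewrite -trM.
Qed.

Fact fps_mulC : commutative fps_mul.
Proof. by move=> f g; apply/fpsP=> n; rewrite -!(@coef_trM n) // mulrC. Qed.

Fact fps_mul1 : left_id fps_one fps_mul.
Proof.
move=> f; apply/fpsP=> n /=; rewrite big_ord_recl /= mul1r subn0 big1 ?addr0 //.
by move=> i _; rewrite mul0r.
Qed.

Fact fps_mulDl : left_distributive fps_mul fps_add.
Proof.
move=> f g h; apply/fpsP=> n /=; rewrite -big_split /=.
by apply: eq_bigr => i _; rewrite mulrDl.
Qed.

Fact fps_one_neq0 : fps_one != 0.
Proof. by apply/eqP => /fpsP/(_ 0%N)/eqP /=; rewrite oner_eq0. Qed.

HB.instance Definition _ := GRing.Zmodule_isComNzRing.Build (fps k)
  fps_mulA fps_mulC fps_mul1 fps_mulDl fps_one_neq0.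

Lemma fcoef0 n : (0 : fps k) n = 0. Proof. by []. Qed.
Lemma fcoef1 n : (1 : fps k) n = (n == 0%N)%:R. Proof. by []. Qed.
Lemma fcoefN f n : (- f) n = - f n. Proof. by []. Qed.
Lemma fcoefD f g n : (f + g) n = f n + g n. Proof. by []. Qed.
Lemma fcoefM f g n : (f * g) n = \sum_(i < n.+1) f i * g (n - i)%N.
Proof. by []. Qed.
Lemma fcoef_sum I (r : seq I) (P : pred I) (F : I -> fps k) n :
  (\sum_(i <- r | P i) F i) n = \sum_(i <- r | P i) F i n.
Proof. by elim/big_rec2: _ => // i x y _ <-. Qed.

Lemma fcoef0M f g : (f * g) 0%N = f 0%N * g 0%N.
Proof. by rewrite fcoefM big_ord1. Qed.

(* [f = f 0 * (1 - u)] with [u 0 = 0], so that [f^-1] is [(f 0)^-1] times the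
   geometric series in [u], whose coefficient of index [n] only involves the
   powers [u ^+ i] with [i <= n]. *)
Definition fps_tail f : fps k :=
  Fps (fun n => if n is 0 then 0 else - (f n / f 0%N)).
Definition fps_inv f : fps k :=
  if f 0%N == 0 then f
  else Fps (fun n => (\sum_(i < n.+1) fps_tail f ^+ i) n / f 0%N).

Lemma fcoefX_lt f : f 0%N = 0 -> forall i n, (n < i)%N -> (f ^+ i) n = 0.
Proof.
move=> f0; elim=> // i IH n; rewrite ltnS => ni; rewrite exprS fcoefM.
rewrite big1 // => -[[|j] /= jn] _; first by rewrite f0 mul0r.
rewrite IH ?mulr0 //; apply: leq_trans ni; rewrite ltn_subrL /=.
by case: n jn.
Qed.

Fact fps_mulV : {in [pred f : fps k | f 0%N != 0], left_inverse 1 fps_inv *%R}.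
Proof.
move=> f; rewrite inE => f0; rewrite /fps_inv (negPf f0).
set u := fps_tail f; pose G m : fps k := \sum_(i < m) u ^+ i.
have u0 : u 0%N = 0 by [].
have fE n : f n = f 0%N * (1 - u) n.
  rewrite fcoefD fcoefN fcoef1; case: n => [|n] /=.
    by rewrite subr0 mulr1.
  by rewrite sub0r opprK mulrC divfK.
have GE m n : (n < m)%N -> G m n = G n.+1 n.
  move=> nm; rewrite /G !fcoef_sum.
  rewrite -[LHS](big_mkord xpredT (fun i => (u ^+ i) n)).
  rewrite -[RHS](big_mkord xpredT (fun i => (u ^+ i) n)).
  rewrite (@big_cat_nat _ _ _ n.+1) //= [X in _ + X]big_nat_cond [X in _ + X]big1
    ?addr0 //.
  by move=> i /andP[/andP[ni _] _]; apply: fcoefX_lt.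
apply/fpsP => n; rewrite fcoefM /=.
transitivity ((G n.+1 * (1 - u)) n).
  rewrite fcoefM; apply: eq_bigr => i _.
  by rewrite [f (n - i)%N]fE (GE n.+1 i) // mulrA divfK.
rewrite mulrC -[1 - u]opprB mulNr -subrX1 opprB.
by rewrite fcoefD fcoefN (@fcoefX_lt u) // subr0.
Qed.

Fact fps_unitP f g : g * f = 1 -> f 0%N != 0.
Proof.
move=> /fpsP/(_ 0%N); rewrite fcoef0M fcoef1 /= => gf1.
by apply: contra_eq_neq gf1 => /eqP; rewrite eq_sym => /eqP <-;
  rewrite mulr0 eq_sym oner_eq0.
Qed.

Fact fps_inv_out : {in [predC [pred f : fps k | f 0%N != 0]], fps_inv =1 id}.
Proof. by move=> f; rewrite !inE negbK /fps_inv => ->. Qed.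

HB.instance Definition _ := GRing.ComNzRing_hasMulInverse.Build (fps k)
  fps_mulV fps_unitP fps_inv_out.

Lemma fps_order f : f != 0 ->
  exists2 n, f n != 0 & forall m, (m < n)%N -> f m = 0.
Proof.
move=> fN0; have exf : exists n, f n != 0.
  apply: contrapT => nf; case/eqP: fN0; apply/fpsP => n.
  by apply/eqP; apply: contrapT => /negP fn; apply: nf; exists n.
case: (ex_minnP exf) => n fn nmin; exists n => // m mn.
by apply/eqP; apply: contraTT mn => /nmin; rewrite leqNgt.
Qed.

Fact fps_integral : GRing.integral_domain_axiom (fps k).
Proof.
move=> f g fg0; apply/negPn/negP; rewrite negb_or.
case/andP=> /fps_order[n fn fmin] /fps_order[m gm gmin].
move/fpsP/(_ (n + m)%N)/eqP: fg0; apply/negP.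
have ltn_nm : (n < (n + m).+1)%N by rewrite ltnS leq_addr.
rewrite fcoefM (bigD1 (Ordinal ltn_nm)) //= addKn big1 ?addr0 ?mulf_neq0 //.
move=> i /eqP iN; have [/fmin->|ni|iE] := ltngtP i n; first by rewrite mul0r.
  by rewrite gmin ?mulr0 // ltn_subLR ?ltn_add2r // -ltnS.
by case: iN; apply/val_inj.
Qed.

HB.instance Definition _ :=
  GRing.ComUnitRing_isIntegral.Build (fps k) fps_integral.

Definition fpsX n : fps k := Fps (fun i => (i == n)%:R).

End FpsRing.

(* The phantom argument [H] of [residue_field] and [laurent] only serves to
   determine the ring [k[[H]]] over which these types are modules. *)

Definition residue_field (k : fieldType) (H : numerical_semigroup) : Type := k.
HB.instance Definition _ (k : fieldType) (H : numerical_semigroup) :=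
  GRing.Field.on (residue_field k H).

Definition laurent (k : fieldType) (H : numerical_semigroup) : Type :=
  {fraction (fps k)}.
HB.instance Definition _ (k : fieldType) (H : numerical_semigroup) :=
  GRing.Field.on (laurent k H).

Section SemigroupRing.
Variables (k : fieldType) (H : numerical_semigroup).

Definition sgring_pred : {pred fps k} :=
  [pred f : fps k | `[< forall n, f n != 0 -> nsg_set H n >]].

Lemma sgring_predP (f : fps k) :
  reflect (forall n, f n != 0 -> nsg_set H n) (f \in sgring_pred).
Proof. exact: asboolP. Qed.

Fact sgring_subring : subring_closed sgring_pred.
Proof.
split=> [|f g /sgring_predP fH /sgring_predP gH|
          f g /sgring_predP fH /sgring_predP gH]; apply/sgring_predP => n.
- by rewrite fcoef1; case: n => [_|n]; [apply: nsg0 | rewrite eqxx].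
- rewrite fcoefD fcoefN => fgn; have [fn|/fH//] := eqVneq (f n) 0.
  by apply: gH; move: fgn; rewrite fn sub0r oppr_eq0.
- rewrite fcoefM => fgn; apply: contrapT => Hn; case/eqP: fgn.
  apply: big1 => i _; apply/eqP/negPn/negP; rewrite mulf_eq0 negb_or.
  case/andP => /fH Hi /gH Hni; apply: Hn.
  by have := nsgD Hi Hni; rewrite subnKC // -ltnS.
Qed.

HB.instance Definition _ :=
  GRing.isSubringClosed.Build (fps k) sgring_pred sgring_subring.

Record sgring := SgRing { sgval :> fps k; _ : sgval \in sgring_pred }.

HB.instance Definition _ := [isSub for sgval].
HB.instance Definition _ := [Choice of sgring by <:].
HB.instance Definition _ := [SubChoice_isSubComNzRing of sgring by <:].

(* An element of [k[[H]]] acts on [k] through its constant term; by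
   [sgring_unitP] the kernel of this augmentation is the ideal of non-units. *)
Definition residue_scale (r : sgring) (c : residue_field k H) :
    residue_field k H :=
  (r 0%N : k) * c.

Fact residue_scaleA a b v :
  residue_scale a (residue_scale b v) = residue_scale (a * b) v.
Proof. by rewrite /residue_scale mulrA -fcoef0M. Qed.
Fact residue_scale1 : left_id 1 residue_scale.
Proof. by move=> v; rewrite /residue_scale /= mul1r. Qed.
Fact residue_scaleDr : right_distributive residue_scale +%R.
Proof. by move=> a u v; rewrite /residue_scale mulrDr. Qed.
Fact residue_scaleDl v : {morph residue_scale^~ v : a b / a + b}.
Proof. by move=> a b; rewrite /residue_scale /= mulrDl. Qed.

HB.instance Definition _ := GRing.Zmodule_isLmodule.Build sgring
  (residue_field k H) residue_scaleA residue_scale1 residue_scaleDr residue_scaleDl.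

Lemma sgring_unitP (r : sgring) : (exists s, s * r = 1) <-> r 0%N != 0.
Proof.
split=> [[s /(congr1 val)]|r0]; first exact: fps_unitP.
have uH : fps_tail r \in sgring_pred.
  apply/sgring_predP => -[|n] /=; first by rewrite eqxx.
  rewrite oppr_eq0 mulf_eq0 negb_or => /andP[rn _].
  exact: (sgring_predP _ (valP r)).
have vH : fps_inv r \in sgring_pred.
  apply/sgring_predP => n; rewrite /fps_inv (negPf r0) /=.
  rewrite mulf_eq0 negb_or => /andP[Gn _].
  have : \sum_(i < n.+1) fps_tail r ^+ i \in sgring_pred.
    by apply: rpred_sum => i _; apply: rpredX.
  by move/sgring_predP; apply.
by exists (SgRing vH); apply/val_inj/fps_mulV; rewrite inE.
Qed.

Definition laurent_scale (r : sgring) (x : laurent k H) : laurent k H :=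
  FracField.tofrac (sgval r) * x.

Fact laurent_scaleA a b v :
  laurent_scale a (laurent_scale b v) = laurent_scale (a * b) v.
Proof. by rewrite /laurent_scale mulrA rmorphM. Qed.
Fact laurent_scale1 : left_id 1 laurent_scale.
Proof. by move=> v; rewrite /laurent_scale rmorph1 mul1r. Qed.
Fact laurent_scaleDr : right_distributive laurent_scale +%R.
Proof. by move=> a u v; rewrite /laurent_scale mulrDr. Qed.
Fact laurent_scaleDl v : {morph laurent_scale^~ v : a b / a + b}.
Proof. by move=> a b; rewrite /laurent_scale rmorphD mulrDl. Qed.

HB.instance Definition _ := GRing.Zmodule_isLmodule.Build sgring (laurent k H)
  laurent_scaleA laurent_scale1 laurent_scaleDr laurent_scaleDl.

Definition tinv (n : nat) : laurent k H := (FracField.tofrac (fpsX k n))^-1.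

End SemigroupRing.

Section Modules.
Variables (R : comNzRingType) (V : lmodType R).

Definition span (S : set V) : {pred V} :=
  [pred x | `[< exists n (r : 'I_n -> R) (v : 'I_n -> V),
                  (forall i, S (v i)) /\ x = \sum_i r i *: v i >]].

Lemma spanP (S : set V) x :
  reflect (exists n (r : 'I_n -> R) (v : 'I_n -> V),
             (forall i, S (v i)) /\ x = \sum_i r i *: v i) (x \in span S).
Proof. exact: asboolP. Qed.

Lemma mem_span (S : set V) x : S x -> x \in span S.
Proof.
move=> Sx; apply/spanP; exists 1%N, (fun=> 1), (fun=> x).
by rewrite big_ord1 scale1r.
Qed.

Fact span_submod (S : set V) : submod_closed (span S).
Proof.
split=> [|a x y /spanP[n [r [v [Sv ->]]]] /spanP[m [s [w [Sw ->]]]]];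
  apply/spanP.
  exists 0%N, (fun=> 0), (fun=> 0).
  by split=> [[]//|]; rewrite big_ord0.
exists (n + m)%N,
  (fun i => match fintype.split i with inl j => a * r j | inr j => s j end),
  (fun i => match fintype.split i with inl j => v j | inr j => w j end).
split=> [i|]; first by case: fintype.split.
rewrite big_split_ord scaler_sumr /=; congr (_ + _); apply: eq_bigr => i _.
  by rewrite (unsplitK (inl i)) scalerA.
by rewrite (unsplitK (inr i)).
Qed.

HB.instance Definition _ (S : set V) :=
  GRing.isSubmodClosed.Build R V (span S) (span_submod S).

Section Quotient.
Variable S : set V.

Definition quotmod : Type := Quotient.quot (span S).
HB.instance Definition _ := GRing.Zmodule.on quotmod.

Definition quotmod_pi (x : V) : quotmod := \pi_(Quotient.quot (span S))%qT x.

Lemma quotmod_piP x y : quotmod_pi x = quotmod_pi y <-> x - y \in span S.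
Proof. by rewrite Quotient.idealrBE; split=> /eqP. Qed.

Lemma quotmod_surj (q : quotmod) : exists x, quotmod_pi x = q.
Proof. by exists (repr q); apply: reprK. Qed.

Fact quotmod_piD : {morph quotmod_pi : x y / x + y}.
Proof. by move=> x y; apply: (raddfD (\pi_(Quotient.quot (span S))%qT)). Qed.

Definition quotmod_scale (a : R) (q : quotmod) : quotmod :=
  quotmod_pi (a *: repr (q : Quotient.quot (span S))).

Fact quotmod_scale_pi a x : quotmod_scale a (quotmod_pi x) = quotmod_pi (a *: x).
Proof.
by apply/quotmod_piP; rewrite -scalerBr rpredZ //; apply/quotmod_piP/reprK.
Qed.

Fact quotmod_scaleA a b v :
  quotmod_scale a (quotmod_scale b v) = quotmod_scale (a * b) v.
Proof.
by have [x <-] := quotmod_surj v; rewrite !quotmod_scale_pi scalerA.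
Qed.
Fact quotmod_scale1 : left_id 1 quotmod_scale.
Proof.
by move=> v; have [x <-] := quotmod_surj v; rewrite quotmod_scale_pi scale1r.
Qed.
Fact quotmod_scaleDr : right_distributive quotmod_scale +%R.
Proof.
move=> a u v; have [x <-] := quotmod_surj u; have [y <-] := quotmod_surj v.
by rewrite -quotmod_piD !quotmod_scale_pi scalerDr quotmod_piD.
Qed.
Fact quotmod_scaleDl v : {morph quotmod_scale^~ v : a b / a + b}.
Proof.
move=> a b; have [x <-] := quotmod_surj v.
by rewrite !quotmod_scale_pi scalerDl quotmod_piD.
Qed.

HB.instance Definition _ := GRing.Zmodule_isLmodule.Build R quotmod
  quotmod_scaleA quotmod_scale1 quotmod_scaleDr quotmod_scaleDl.

End Quotient.

Definition is_direct_summand (W : lmodType R) : Prop :=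
  exists (N : lmodType R) (f : {linear (W * N)%type -> V}), bijective f.

End Modules.

(* [is_direct_summand M W]: the module [W] is a direct summand of [M]. *)
Arguments is_direct_summand {R} V W.

Definition short_exact (R : comNzRingType) (A B C : lmodType R)
    (f : {linear A -> B}) (g : {linear B -> C}) : Prop :=
  [/\ injective f, (forall b, g b = 0 <-> exists a, f a = b)
    & (forall c, exists b, g b = c)].

Section Canonical.
Variables (k : fieldType) (H : numerical_semigroup).

Definition omega_pred : {pred laurent k H} :=
  span [set tinv k H c | c in PF H]%classic.

HB.instance Definition _ := GRing.isSubmodClosed.Build (sgring k H)
  (laurent k H) omega_pred (span_submod _).

Record omega := Omega { omega_val :> laurent k H; _ : omega_val \in omega_pred }.

HB.instance Definition _ := [isSub for omega_val].
HB.instance Definition _ := [Choice of omega by <:].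
HB.instance Definition _ :=
  [SubChoice_isSubLmodule of omega by <:].

Fact tinv_omega d : PF H d -> tinv k H d \in omega_pred.
Proof. by move=> Hd; apply: mem_span; exists d. Qed.

Definition omega_gen d (Hd : PF H d) : omega := Omega (tinv_omega Hd).

End Canonical.

(* Main.v *)
(* For c in PF(H), extracting the coefficient of t^-c is an R-linear map from
   omega to k, and every R-linear map from omega to k is a combination of these.
   If a, b and a + b are in PF(H), then t^-a is killed by the maximal ideal
   modulo R t^-(a + b), because t^h t^-a = t^(h + b) t^-(a + b), and the
   coefficient of t^-a splits k t^-a off omega / R t^-(a + b).
   Conversely, a summand k of omega / R z gives an x in omega, not killed by some
   linear map p to k with p z = 0, such that m x lies in R z.  Then x = q z with
   q in R : m, so up to a multiple of z the exponents of q are in PF(H).  Since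
   p x <> 0, some coefficient of t^-a in x, with a in PF(H), is nonzero, so z has
   a nonzero coefficient at t^-(a + b) for some b in PF(H).  Hence a + b is not
   in H, and therefore in PF(H). *)
From HB Require Import structures.
Require Import Defs.
From mathcomp Require Import all_boot all_order all_algebra.
From mathcomp Require Import generic_quotient ring_quotient fraction.
From mathcomp Require Import boolp classical_sets functions cardinality.
From mathcomp Require Import zify.
Import GRing.Theory.
Local Open Scope ring_scope.

Set Implicit Arguments.
Unset Strict Implicit.
Unset Printing Implicit Defensive.

Lemma linear_for_exists (R : nzRingType) (U V : lmodType R) (f : U -> V) :
  linear f -> exists g : {linear U -> V}, g =1 f.
Proof.
move=> lf; pose m := GRing.isLinear.Build R U V *:%R f lf.
pose g : {linear U -> V} := HB.pack f m.
by exists g.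
Qed.

(** * Direct summands from split surjections *)

Section Retract.
Variables (R : comNzRingType) (V W : lmodType R) (p : {linear V -> W}).

Definition ker_pred : {pred V} := [pred x | p x == 0].

Fact ker_submod : submod_closed ker_pred.
Proof.
split=> [|a x y]; rewrite !inE ?linear0 // => /eqP px /eqP py.
by rewrite linearP px py scaler0 addr0.
Qed.

HB.instance Definition _ := GRing.isSubmodClosed.Build R V ker_pred ker_submod.

Record ker_mod := KerMod { ker_val : V; _ : ker_val \in ker_pred }.

HB.instance Definition _ := [isSub for ker_val].
HB.instance Definition _ := [Choice of ker_mod by <:].
HB.instance Definition _ := [SubChoice_isSubLmodule of ker_mod by <:].

(** The kernel of [p] is a complement of the image of [i]: write [v] as [i (p v)] plus
    [v - i (p v)]. *)
Lemma retract_direct_summand (i : {linear W -> V}) :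
  cancel i p -> is_direct_summand V W.
Proof.
move=> ip; pose F (u : (W * ker_mod)%type) : V := i u.1 + \val u.2.
have lF : linear F.
  move=> a [u1 u2] [v1 v2]; rewrite /F /=.
  by rewrite !linearP /= scalerDr addrACA.
have [f fE] := linear_for_exists lF.
have kerP v : v - i (p v) \in ker_pred by rewrite inE linearB /= ip subrr.
exists ker_mod, f; exists (fun v => (p v, KerMod (kerP v))) => [[u1 [u2 u2P]]|v].
  have pu2 : p u2 = 0 by move: u2P; rewrite inE => /eqP.
  have pE : p (f (u1, KerMod u2P)) = u1.
    by rewrite fE /F linearD /= ip pu2 addr0.
  congr (_, _) => //; apply/val_inj => /=.
  by rewrite pE fE /F /= addrC addKr.
by rewrite fE /F /= addrC subrK.
Qed.

End Retract.

(** * Monomials and orders of power series *)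

Section PowerSeries.
Variable k : fieldType.
Implicit Types f g : fps k.

Lemma fcoefXM n f i :
  (fpsX k n * f) i = if (i < n)%N then 0 else f (i - n)%N.
Proof.
rewrite fcoefM; case: ltnP => [lt_in|le_ni].
  rewrite big1 // => -[j /= lt_ji] _; rewrite (_ : (j == n) = false) ?mul0r //.
  by apply/eqP; lia.
rewrite (bigD1 (Ordinal (le_ni : (n < i.+1)%N))) //= eqxx mul1r.
rewrite big1 ?addr0 // => -[j /= lt_ji] /eqP jn.
rewrite (_ : (j == n) = false) ?mul0r //.
by apply/eqP => jnE; apply: jn; apply/val_inj.
Qed.

Lemma fpsXD m n : fpsX k (m + n) = fpsX k m * fpsX k n.
Proof.
apply/fpsP => i; rewrite fcoefXM /=; case: ltnP => [lt_im|le_mi].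
  by rewrite (_ : (i == _) = false) //; apply/eqP; lia.
by rewrite -[in LHS](subnKC le_mi) eqn_add2l.
Qed.

Lemma fpsX_neq0 n : fpsX k n != 0.
Proof. by apply/eqP => /fpsP/(_ n)/eqP; rewrite /= eqxx oner_eq0. Qed.

Lemma fps_factor f :
  f != 0 -> exists n (u : fps k), u 0%N != 0 /\ f = fpsX k n * u.
Proof.
case/fps_order=> n fn fmin; exists n, (Fps (fun i => f (n + i)%N)).
split; first by rewrite /= addn0.
apply/fpsP => i; rewrite fcoefXM; case: ltnP => [/fmin//|le_ni] /=.
by rewrite subnKC.
Qed.

(** Both exponents are the order of the common product. *)
Lemma fpsXM_inj m n f g : f 0%N != 0 -> g 0%N != 0 ->
  fpsX k m * f = fpsX k n * g -> m = n.
Proof.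
move=> f0 g0 /fpsP fg; apply/eqP; rewrite eqn_leq; apply/andP; split.
  rewrite leqNgt; apply/negP => lt_nm; have := fg n.
  by rewrite !fcoefXM lt_nm ltnn subnn => /esym/eqP; apply/negP.
rewrite leqNgt; apply/negP => lt_mn; have := fg m.
by rewrite !fcoefXM lt_mn ltnn subnn => /eqP; apply/negP.
Qed.

End PowerSeries.

(** * Gaps of a numerical semigroup *)

Section Shift.
Variable H : numerical_semigroup.

Lemma nsg_bound : exists N, forall n, ~ nsg_set H n -> (n <= N)%N.
Proof.
have /finite_seqP[s sE] := nsg_cofinite H.
exists (\max_(i <- s) i)%N => n Hn; apply: (@leq_bigmax_seq _ _ xpredT id) => //.
by move: (Hn : (~` nsg_set H)%classic n); rewrite sE.
Qed.

(** Subtracting [i] repeatedly from an element of [H] must end at 0, so [i] divides all of [H]. As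
    [H] contains two consecutive numbers, [i = 1]; descending by 1 from large elements then reaches
    every natural number. *)
Lemma nsg_no_shift i : (nsg_set H `<` [set: nat])%classic -> (0 < i)%N ->
  ~ (forall h, nsg_set H h -> (0 < h)%N -> (i <= h)%N /\ nsg_set H (h - i)%N).
Proof.
case=> _ properH i0 shift; have [N gapN] := nsg_bound.
have i_dvd h : nsg_set H h -> (i %| h)%N.
  elim/ltn_ind: h => -[//|h] IH Hh; have [le_ih Hhi] := shift _ Hh isT.
  by rewrite -(subnK le_ih) dvdn_addl ?dvdnn // IH //; lia.
have HN n : (N < n)%N -> nsg_set H n.
  by move=> lt_Nn; apply: contrapT => /gapN; rewrite leqNgt lt_Nn.
have i1 : i = 1%N.
  apply/eqP; rewrite -dvdn1; have := i_dvd _ (HN N.+2 (leqnSn _)).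
  by rewrite -addn1 dvdn_addr // i_dvd //; apply: HN.
apply: properH => n _; have Hdown m : nsg_set H (n + N.+1 - m)%N.
  elim: m => [|m IH]; first by apply: HN; lia.
  rewrite subnS; case: (_ - m)%N IH => // j /shift/(_ isT)[].
  by rewrite i1 subn1.
by have := Hdown N.+1; rewrite addnK.
Qed.

End Shift.

Section Canonical.
Variables (k : fieldType) (H : numerical_semigroup).
Local Notation R := (sgring k H).
Local Notation w := (omega k H).

Lemma PF_gt0 a : PF H a -> (0 < a)%N.
Proof. by case: a => // -[/(_ (nsg0 H))]. Qed.

Lemma sgring_supp (r : R) n : r n != 0 -> nsg_set H n.
Proof. by have /sgring_predP := valP r; apply. Qed.

Fact fpsX_sgring h : nsg_set H h -> fpsX k h \in sgring_pred H.
Proof.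
by move=> Hh; apply/sgring_predP => n /=; have [->|_] := eqVneq n h; rewrite ?eqxx.
Qed.

Definition sgX h (Hh : nsg_set H h) : R := SgRing (fpsX_sgring Hh).

Lemma omega_decomp (y : w) : exists n (r : 'I_n -> R) (d : 'I_n -> {d | PF H d}),
  y = \sum_i r i *: omega_gen k (svalP (d i)).
Proof.
have /spanP[n [r [v [Sv yE]]]] := valP y.
have /boolp.choice[d dE] i : exists d : {d | PF H d}, tinv k H (sval d) = v i.
  by have [c Hc <-] := Sv i; exists (exist _ c Hc).
exists n, r, d; apply/val_inj; rewrite raddf_sum /= yE.
by apply: eq_bigr => i _; rewrite dE.
Qed.

(** * Coefficients of elements of omega, read off after multiplication by t^N *)

Section Numerator.
Variable N : nat.
Hypothesis gapN : forall n, ~ nsg_set H n -> (n <= N)%N.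

Lemma PF_le d : PF H d -> (d <= N)%N. Proof. by case=> + _; apply: gapN. Qed.

Lemma tinvE d : (d <= N)%N ->
  FracField.tofrac (fpsX k N) * tinv k H d = FracField.tofrac (fpsX k (N - d)).
Proof.
move=> dN; rewrite -[in LHS](subnK dN) fpsXD rmorphM /= /tinv mulfK //.
by rewrite tofrac_eq0 fpsX_neq0.
Qed.

Lemma numer_exists (y : w) :
  exists p, FracField.tofrac p = FracField.tofrac (fpsX k N) * (y : laurent k H).
Proof.
have [n [r [d ->]]] := omega_decomp y.
exists (\sum_i sgval (r i) * fpsX k (N - sval (d i))).
rewrite raddf_sum -[omega_val _]/(\val _) raddf_sum mulr_sumr.
apply: eq_bigr => i _ /=; rewrite tofracM -tinvE ?PF_le //; last exact: svalP.
by rewrite /= mulrCA.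
Qed.

(* [numer y] is [t^N y], so the coefficient of [t^-a] in [y] is the one of
   index [N - a] in [numer y]. *)
Definition numer (y : w) : fps k := sval (cid (numer_exists y)).

Lemma numerE y : FracField.tofrac (numer y) =
  FracField.tofrac (fpsX k N) * (y : laurent k H).
Proof. by rewrite /numer; case: cid. Qed.

Lemma tofrac_inj : injective (@FracField.tofrac (fps k)).
Proof. by move=> p q /eqP; rewrite tofrac_eq => /eqP. Qed.

Lemma numerD y z : numer (y + z) = numer y + numer z.
Proof. by apply: tofrac_inj; rewrite rmorphD /= !numerE mulrDr. Qed.

Lemma numerZ (r : R) y : numer (r *: y) = sgval r * numer y.
Proof. by apply: tofrac_inj; rewrite rmorphM /= !numerE mulrCA. Qed.

Lemma numer0 : numer 0 = 0.
Proof. by rewrite -(scale0r 0) numerZ mul0r. Qed.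

Lemma numer_sum I (s : seq I) (F : I -> w) :
  numer (\sum_(i <- s) F i) = \sum_(i <- s) numer (F i).
Proof. exact: (big_morph _ numerD numer0). Qed.

Lemma numer_inj : injective numer.
Proof.
move=> y z yz; apply/val_inj/(@mulfI _ (FracField.tofrac (fpsX k N))).
  by rewrite tofrac_eq0 fpsX_neq0.
by rewrite -[LHS]numerE -[RHS]numerE yz.
Qed.

Lemma numer_gen d (Hd : PF H d) : numer (omega_gen k Hd) = fpsX k (N - d).
Proof. by apply: tofrac_inj; rewrite numerE tinvE ?PF_le. Qed.

(** Exponents in omega have the form [h - c] with [h] in [H] and [c] in [PF H]. If this is [-a] with
    [a] in [H], then [c = a + h] lies in [H], a contradiction. *)
Lemma numer_supp y a : (a <= N)%N -> numer y (N - a)%N != 0 -> ~ nsg_set H a.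
Proof.
have [n [r [d ->]]] := omega_decomp y; move=> aN + Ha; apply/negP; rewrite negbK.
rewrite numer_sum fcoef_sum big1 // => i _; case: (d i) => c Hc /=.
rewrite numerZ numer_gen mulrC fcoefXM; case: ltnP => // le_ca.
have cN := PF_le Hc; apply: contrapT => /eqP/sgring_supp Hca.
case: Hc => + _; apply; rewrite (_ : c = (a + (N - a - (N - c)))%N); [|lia].
exact: nsgD.
Qed.

(** A term of [r] of degree [i > 0] meets the coefficient of [y] at t^-(a + i), which vanishes since
    [a + i] is in [H]. *)
Lemma numer_coefZ a (r : R) y : PF H a ->
  numer (r *: y) (N - a)%N = r 0%N * numer y (N - a)%N.
Proof.
move=> Ha; have aN := PF_le Ha.
rewrite numerZ fcoefM big_ord_recl /= subn0 big1 ?addr0 // => i _.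
rewrite /bump /= add1n; have [->|/sgring_supp Hi] := eqVneq (r i.+1) 0.
  by rewrite mul0r.
apply/eqP; rewrite mulf_eq0; apply/orP; right; apply/negPn/negP.
have iN := ltn_ord i; rewrite -subnDA => /numer_supp; apply; first lia.
by apply: (proj2 Ha).
Qed.

Lemma residue_scaleE (r : R) (c : residue_field k H) : r *: c = r 0%N * c.
Proof. by []. Qed.

(** Compare orders: adding [ord P - ord Q] sends positive elements of [H] into [H]. A negative
    difference would contradict [nsg_no_shift], so [q = P / Q] is a power series. Since t^h q lies
    in [R] for each positive [h] in [H], every exponent of [q] outside [H] is in [PF H]. *)
Lemma fps_quotient (P Q : fps k) : (nsg_set H `<` [set: nat])%classic ->
  P != 0 -> Q != 0 ->
  (forall h, nsg_set H h -> (0 < h)%N -> exists s : R, fpsX k h * P = sgval s * Q) ->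
  exists q : fps k, P = q * Q /\ forall j, q j != 0 -> nsg_set H j \/ PF H j.
Proof.
move=> properH P0 Q0 mPQ.
have [u [P' [P'0 PE]]] := fps_factor P0; have [v [Q' [Q'0 QE]]] := fps_factor Q0.
have ord_mul h : nsg_set H h -> (0 < h)%N ->
    exists2 e, nsg_set H e & (h + u = e + v)%N.
  move=> Hh /(mPQ _ Hh)[s sE]; have s0 : sgval s != 0.
    apply: contra_eq_neq sE => ->; rewrite mul0r.
    by rewrite mulf_neq0 // fpsX_neq0.
  have [e [s' [s'0 se]]] := fps_factor s0; exists e.
    by apply: (@sgring_supp s); rewrite se fcoefXM ltnn subnn.
  apply: (@fpsXM_inj _ _ _ P' (s' * Q')) => //; first by rewrite fcoef0M mulf_neq0.
  by rewrite !fpsXD -mulrA -PE sE se QE mulrACA.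
have le_vu : (v <= u)%N.
  rewrite leqNgt; apply/negP => lt_uv; apply: (nsg_no_shift properH (i := v - u)).
    by rewrite subn_gt0.
  move=> h Hh h0; have [e He eE] := ord_mul _ Hh h0.
  by split; [lia | rewrite (_ : h - (v - u) = e)%N //; lia].
(* [Q'] is invertible because its constant term is nonzero. *)
have qE : P = fpsX k (u - v) * P' * Q'^-1 * Q.
  rewrite {1}PE QE -{1}(subnK le_vu) fpsXD.
  by rewrite [RHS]mulrACA mulVr // mulr1 mulrAC.
exists (fpsX k (u - v) * P' * Q'^-1); split=> // j qj.
have [Hj|nHj] := pselect (nsg_set H j); [by left|right; split=> // h Hh].
rewrite -lt0n => h0; have [s] := mPQ _ Hh h0; rewrite [in LHS]qE mulrA.
move/(mulIf Q0) => sE; apply: (@sgring_supp s); rewrite -sE fcoefXM.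
by rewrite ltnNge leq_addl /= addnK.
Qed.

Lemma PF_coef_neq0 (p : {linear w -> residue_field k H}) y : p y != 0 ->
  exists2 a, PF H a & numer y (N - a)%N != 0.
Proof.
(* The weight of the coefficient at t^-a is the value of [p] at t^-a; the default 0 outside [PF H]
   lets the sum run over all [a <= N]. On a generator t^-c only the term [a = c] survives. *)
pose pc a : k := if pselect (PF H a) is left Ha then p (omega_gen k Ha) else 0.
have pE : p y = \sum_(a < N.+1) numer y (N - a)%N * pc a.
  have [n [r [d ->]]] := omega_decomp y; rewrite linear_sum numer_sum.
  under [RHS]eq_bigr do rewrite fcoef_sum mulr_suml.
  rewrite exchange_big; apply: eq_bigr => i _ /=; case: (d i) => c Hc /=.
  have cN := PF_le Hc.
  rewrite linearZ /= residue_scaleE (bigD1 (Ordinal (cN : (c < N.+1)%N))) //=.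
  rewrite numer_coefZ // numer_gen /= eqxx mulr1 big1 ?addr0.
    congr (_ * _); rewrite /pc; case: pselect => // Hc'.
    by congr (p _); apply/val_inj.
  move=> a /eqP ac; rewrite /pc; case: pselect => [Ha|_]; last by rewrite mulr0.
  rewrite numer_coefZ // numer_gen /= (_ : (_ == _) = false) ?mulr0 ?mul0r //.
  by apply/eqP => acE; apply: ac; apply/val_inj => /=; have := ltn_ord a; lia.
rewrite pE => py; apply: contrapT => nex; case/eqP: py; apply: big1 => a _.
rewrite /pc; case: pselect => [Ha|_]; last by rewrite mulr0.
have [->|ya] := eqVneq (numer y (N - a)%N) 0; first by rewrite mul0r.
by case: nex; exists a.
Qed.

Lemma PF_add_of_socle (p : {linear w -> residue_field k H}) (x z : w) :
  (nsg_set H `<` [set: nat])%classic -> z != 0 -> p z = 0 -> p x != 0 ->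
  (forall r : R, r 0%N = 0 -> exists s : R, r *: x = s *: z) ->
  exists a b, [/\ PF H a, PF H b & PF H (a + b)%N].
Proof.
move=> properH z0 pz px mxz.
have x0 : numer x != 0.
  by apply: contraNneq px; rewrite -numer0 => /numer_inj->; rewrite linear0.
have z0' : numer z != 0.
  by apply: contraNneq z0; rewrite -numer0 => /numer_inj->.
have [h Hh h0|q [xE qH]] := fps_quotient properH x0 z0'.
  have [|s /(congr1 numer)] := mxz (sgX Hh); last by rewrite !numerZ; exists s.
  by rewrite /= (_ : (_ == _) = false) //; apply/eqP; lia.
(* [rf] is the part of [q] supported on [H], hence in [R]. Subtracting [r *: z] from [x] keeps the
   value of [p], as [p z = 0], and leaves the multiplier [q - rf], supported on [PF H]. *)
pose rf := Fps (fun n => if `[< nsg_set H n >] then q n else 0).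
have rH : rf \in sgring_pred H.
  by apply/sgring_predP => n /=; case: asboolP; rewrite ?eqxx.
pose r : R := SgRing rH; pose y := x - r *: z.
have yE : numer y = (q - rf) * numer z.
  by rewrite /y -scaleNr numerD numerZ xE mulrDl.
have py : p y != 0 by rewrite linearB linearZ /= pz scaler0 subr0.
(* A nonzero coefficient of [y] at t^-a needs a term of [q - rf] of some degree [i] and a term of
   [z] at t^-(a + i), so [a + i] is a gap. *)
have [a Ha] := PF_coef_neq0 py; rewrite yE fcoefM => sum_neq0.
have [i qzi] : exists i : 'I_(N - a).+1, (q - rf) i * numer z (N - a - i)%N != 0.
  apply: contrapT => nex; case/eqP: sum_neq0; apply: big1 => i _.
  by apply: contrapT => /eqP ni; apply: nex; exists i.
move: qzi; rewrite mulf_eq0 negb_or => /andP[qi zi].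
have Hi : PF H i.
  move: qi; rewrite fcoefD fcoefN /=; case: asboolP => [_|nHi].
    by rewrite subrr eqxx.
  by rewrite subr0 => /qH[].
exists a, i; split=> //; split.
  move: zi; rewrite -subnDA; apply: numer_supp.
  by have := ltn_ord i; have := PF_le Ha; lia.
move=> h Hh h0; rewrite -addnA; apply: (proj2 Ha); first exact: (proj2 Hi).
by rewrite -lt0n; have := PF_gt0 Hi; lia.
Qed.

Lemma residue_summand a b (Ha : PF H a) (Hb : PF H b) (Hab : PF H (a + b)%N) :
  is_direct_summand (quotmod [set omega_gen k Hab]%classic) (residue_field k H).
Proof.
set S := [set _]%classic; pose phi (y : w) : residue_field k H := numer y (N - a)%N.
have phiL r y z : phi (r *: y + z) = r *: phi y + phi z.
  by rewrite /phi numerD fcoefD numer_coefZ.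
(* As [b > 0], the generator t^-(a + b) has zero coefficient at t^-a. *)
have phi0 y : y \in Defs.span S -> phi y = 0.
  case/spanP=> n [r [v [Sv ->]]]; rewrite /phi numer_sum fcoef_sum big1 // => i _.
  rewrite numer_coefZ // Sv numer_gen /= (_ : (_ == _) = false) ?mulr0 //.
  by apply/eqP; have := PF_gt0 Hb; have := PF_le Hab; lia.
have phiB y z : y - z \in Defs.span S -> phi y = phi z.
  move/phi0; rewrite -scaleN1r addrC phiL scaleN1r => /eqP.
  by rewrite addrC subr_eq0 => /eqP.
pose P (u : quotmod S) : residue_field k H :=
  phi (repr (u : Quotient.quot (Defs.span S))).
have P_pi y : P (quotmod_pi S y) = phi y.
  by apply: phiB; apply/quotmod_piP/reprK.
have PL : linear P.
  move=> r u v; have [y <-] := quotmod_surj u; have [z <-] := quotmod_surj v.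
  rewrite -[r *: _]/(quotmod_scale _ _) quotmod_scale_pi -quotmod_piD !P_pi.
  exact: phiL.
have [p pE] := linear_for_exists PL.
have cH (c : k) : Fps (fun n => if n is 0 then c else 0) \in sgring_pred H.
  by apply/sgring_predP => -[_|n]; [exact: nsg0|rewrite eqxx].
pose cst (c : residue_field k H) : R := SgRing (cH c).
pose I c := quotmod_pi S (cst c *: omega_gen k Ha).
have IL : linear I.
  move=> r c d; rewrite /I -[r *: quotmod_pi _ _]/(quotmod_scale _ _).
  rewrite quotmod_scale_pi -quotmod_piD; apply/quotmod_piP.
  (* The defect of linearity is s t^-a, where [s] has zero constant term. It equals (s t^b) t^-(a +
     b), and s t^b is in [R] because [b] is in [PF H]. *)
  rewrite scalerA -scalerDl -scalerBl; set s : R := _ - _.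
  have s0 : s 0%N = 0.
    have sE : sgval s = sgval (cst (r *: c + d)) -
        (sgval r * sgval (cst c) + sgval (cst d)) by [].
    by rewrite sE fcoefD fcoefN fcoefD fcoef0M /= subrr.
  have sH : sgval s * fpsX k b \in sgring_pred H.
    apply/sgring_predP => n; rewrite mulrC fcoefXM; case: ltnP; rewrite ?eqxx //.
    move=> le_bn sn; rewrite -(subnKC le_bn); apply: (proj2 Hb).
      exact: sgring_supp sn.
    by apply: contraNneq sn => ->; rewrite s0.
  have -> : s *: omega_gen k Ha = SgRing sH *: omega_gen k Hab.
    apply: numer_inj; rewrite !numerZ !numer_gen /= -mulrA -fpsXD.
    by congr (_ * fpsX _ _); have := PF_le Hab; lia.
  by apply: rpredZ; apply: mem_span.
have [i iE] := linear_for_exists IL.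
apply: (@retract_direct_summand _ _ _ p i) => c.
by rewrite iE pE P_pi /phi numer_coefZ // numer_gen /= eqxx mulr1.
Qed.

End Numerator.

End Canonical.

(** * The exact sequence given by a generator of omega *)

Lemma span1P (R : comNzRingType) (V : lmodType R) (z x : V) :
  x \in Defs.span [set z]%classic -> exists s : R, x = s *: z.
Proof.
case/spanP=> n [r [v [vE ->]]]; exists (\sum_i r i); rewrite scaler_suml.
by apply: eq_bigr => i _; rewrite vE.
Qed.

Lemma quotmod_short_exact (k : fieldType) (H : numerical_semigroup) d
  (Hd : PF H d) :
  exists (f : {linear (sgring k H)^o -> omega k H})
    (g : {linear omega k H -> quotmod [set omega_gen k Hd]%classic}),
  short_exact f g.
Proof.
set z := omega_gen k Hd; set S := [set z]%classic.
have fL : linear (fun r : (sgring k H)^o => (r : sgring k H) *: z).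
  by move=> r s t; rewrite scalerDl scalerA.
have gL : linear (quotmod_pi S).
  move=> r y t; rewrite quotmod_piD -[r *: quotmod_pi _ _]/(quotmod_scale _ _).
  by rewrite quotmod_scale_pi.
have [f fE] := linear_for_exists fL; have [g gE] := linear_for_exists gL.
have [N gapN] := nsg_bound H.
exists f, g; split=> [r s|y|c].
(* Numerators live in a domain, so the nonzero monomial t^(N - d) cancels. *)
- rewrite !fE => /(congr1 (numer gapN)); rewrite !numerZ numer_gen.
  by move/(mulIf (fpsX_neq0 _ _)) => rs; apply/val_inj.
- rewrite gE -(_ : quotmod_pi S 0 = 0); last by rewrite -gE linear0.
  split=> [/quotmod_piP|[r <-]].
    by rewrite subr0 => /span1P[r ->]; exists r; rewrite fE.
  by apply/quotmod_piP; rewrite subr0 fE; apply/rpredZ/mem_span.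
- by have [y <-] := quotmod_surj c; exists y; rewrite gE.
Qed.

(** * The cycle (ii) => (i) => (iii) => (ii) *)

Theorem theorem1p3 (k : fieldType) (H : numerical_semigroup)
    (H_proper : (nsg_set H `<` [set: nat])%classic) :
  let R := sgring k H in
  let cond_i :=
    exists (C : lmodType R) (f : {linear R^o -> omega k H})
           (g : {linear omega k H -> C}),
      [/\ short_exact f g, (exists c : C, c != 0)
        & is_direct_summand C (residue_field k H)] in
  let cond_ii :=
    exists (d : nat) (Hd : PF H d),
      is_direct_summand (quotmod [set omega_gen k Hd]%classic)
                        (residue_field k H) in
  let cond_iii :=
    exists a b : nat, [/\ PF H a, PF H b & PF H (a + b)%N] in
  (cond_i <-> cond_ii) /\ (cond_ii <-> cond_iii).
Proof.
move=> R cond_i cond_ii cond_iii.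
have ii_i : cond_ii -> cond_i.
  case=> d [Hd kM]; have [f [g fg]] := quotmod_short_exact k Hd.
  exists (quotmod [set omega_gen k Hd]%classic), f, g; split=> //.
  (* The copy of [k] in the quotient supplies a nonzero element. *)
  have [M [u u_bij]] := kM; exists (u (1, 0)); apply/eqP.
  rewrite -(linear0 u) => /(bij_inj u_bij)[/eqP]; apply/negP; exact: oner_neq0.
have i_iii : cond_i -> cond_iii.
  case=> C [f [g [[f_inj fg g_surj] _ [M [u [u' uK u'K]]]]]].
  (* The projection to the summand [k]; the bare inverse [u'] inherits linearity from [u]. *)
  have pL : linear (fun y => (u' (g y)).1 : residue_field k H).
    move=> r y z; rewrite linearP.
    have -> : u' (r *: g y + g z) = r *: u' (g y) + u' (g z).
      by apply: (can_inj uK); rewrite linearP !u'K.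
    by [].
  have [p pE] := linear_for_exists pL.
  (* [x] lifts the generator of the summand [k], and [f 1] serves as [z]. *)
  have [x xE] := g_surj (u (1, 0)); have [N gapN] := nsg_bound H.
  apply: (@PF_add_of_socle k H N gapN p x (f 1)) => //.
  - by apply/eqP; rewrite -(linear0 f) => /f_inj/eqP; rewrite oner_eq0.
  - have gf1 : g (f 1) = 0 by apply/fg; exists 1.
    by rewrite pE gf1 -(linear0 u) uK.
  - by rewrite pE xE uK oner_neq0.
  (* Non-units of [R] kill [k], so [r *: x] lies in the kernel of [g], which is the image of [f],
     that is, the multiples of [f 1]. *)
  - move=> r r0; have /fg[s sE] : g (r *: x) = 0.
      rewrite linearZ /= xE -linearZ -[RHS](linear0 u); congr (u _).
      congr (_, _); last exact: scaler0.
      by rewrite /= /GRing.scale /= /residue_scale r0 mul0r.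
    by exists s; rewrite -sE -linearZ; congr (f _); rewrite -[LHS]mulr1.
have iii_ii : cond_iii -> cond_ii.
  case=> a [b [Ha Hb Hab]]; have [N gapN] := nsg_bound H.
  by exists (a + b)%N, Hab; exact: (residue_summand k gapN Ha Hb).
by split; split; auto.
Qed.
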